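(* There exists a constant $\theta>0$ such that for all odd integers $n\ge 3$ and all integers $\xi$ with $1\le\xi\le\frac{n}{\log n}$, the smallest eigenvalue $\beta_*(\xi)$ of $M(\xi)$ satisfies $$\beta_*(\xi)\ge -1+\theta\left(\frac{\xi}{n}\right)^{4/3}.$$
   Context: For integers $n\ge 3$ and $\xi$, $M(\xi)$ is the real symmetric $n\times n$ matrix with rows and columns indexed by $0,1,\dots,n-1$, with diagonal entries $\frac12\cos\left(\frac{2\pi\xi j}{n}\right)$ for $0\le j\le n-1$, entries $\frac14$ on the superdiagonal and the subdiagonal and in the upper right and lower left corners, and all other entries $0$. Here $\log$ is the natural logarithm. *)

(* Defs.v *)
From HB Require Import structures.
From mathcomp Require Import all_boot all_order all_algebra.
From mathcomp Require Import all_classical all_reals all_analysis.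
From mathcomp Require complex polyrcf.

Set Implicit Arguments.
Unset Strict Implicit.
Unset Printing Implicit Defensive.

Import Order.TTheory GRing.Theory Num.Theory.
Local Open Scope ring_scope.

(* The non-zero off-diagonal positions are pairwise distinct once 3 <= n. *)
Definition M (R : realType) (n : nat) (xi : int) : 'M[R]_n :=
  \matrix_(i < n, j < n)
    if i == j then 1 / 2 * cos (2 * pi * xi%:~R * j%:R / n%:R)
    else if [|| j == i.+1 :> nat, i == j.+1 :> nat,
                (i == 0 :> nat)%N && (j == n.-1 :> nat) |
                (i == n.-1 :> nat) && (j == 0 :> nat)%N] then 1 / 4
    else 0.

Definition is_smallest_eigenvalue (R : realType) (n : nat) (A : 'M[R]_n)
    (b : R) : Prop :=
  eigenvalue A b /\ forall a : R, eigenvalue A a -> b <= a.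

Lemma M_sym (R : realType) (n : nat) (xi : int) : (M R n xi)^T = M R n xi.
Proof.
apply/matrixP => i j; rewrite !mxE [j == i]eq_sym.
case: (eqVneq i j) => [->//|_]; congr (if _ then _ else _).
rewrite orbCA; congr [|| _, _ | _].
by rewrite orbC [X in X || _]andbC [X in _ || X]andbC.
Qed.

Section SymmetricSpectrum.
Import complex.
Local Open Scope complex_scope.

Lemma sym_eigenvalue (R : realType) (n : nat) (A : 'M[R]_n) :
  (0 < n)%N -> A^T = A -> exists a, eigenvalue A a.
Proof.
move=> n0 As; pose f := real_complex R.
have [a av] := @spectral.eigenvalue_closed R[i] n (map_mx f A) n0.
have [v vA v0] := eigenvalueP av.
pose g := Num.conj : R[i] -> R[i].
pose w := map_mx g v.
have gA : map_mx g (map_mx f A) = map_mx f A.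
  apply/matrixP => i j; rewrite !mxE /g; apply/CrealP.
  by rewrite complex_real.
have wA : w *m map_mx f A = g a *: w.
  by rewrite -{1}gA -map_mxM vA map_mxZ.
have e : a *: (v *m w^T) = g a *: (v *m w^T).
  rewrite [LHS]scalemxAl -vA -mulmxA -[in LHS]As -map_trmx -trmx_mul wA.
  by rewrite linearZ /= -scalemxAr.
have vw : (v *m w^T) 0 0 != 0.
  apply: contra v0 => /eqP; rewrite mxE => h.
  apply/eqP/rowP => i; rewrite mxE; apply/eqP; rewrite -normr_eq0 -sqrf_eq0.
  rewrite normCK.
  have := h; under eq_bigr do rewrite !mxE.
  by move/psumr_eq0P => /(_ (fun k _ => mul_conjC_ge0 (v 0 k))) /(_ i isT) ->.
have /CrealP/complex_realP[k ak] : Num.conj a = a.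
  have /matrixP/(_ 0 0) := e; rewrite mxE [RHS]mxE => /(mulIf vw).
  by move=> {2}->.
by exists k; move: av; rewrite ak eigenvalue_map.
Qed.

End SymmetricSpectrum.

Lemma smallest_eigenvalue_exists (R : realType) (n : nat) (A : 'M[R]_n) :
  (0 < n)%N -> A^T = A -> exists b, is_smallest_eigenvalue A b.
Proof.
move=> n0 As; have [a0 ha0] := sym_eigenvalue n0 As.
have rE a : eigenvalue A a = (a \in polyrcf.rootsR (char_poly A)).
  rewrite eigenvalue_root_char -polyrcf.roots_on_rootsR ?itv_boundlr //.
  exact/monic_neq0/char_poly_monic.
have minP (s : seq R) x : x \in s ->
    exists2 b, b \in s & forall a, a \in s -> b <= a.
  elim: s x => // y s IH x _.
  have [->|s0] := eqVneq s [::].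
    by exists y => [|a]; rewrite ?mem_seq1 // => /eqP ->.
  have [b bs hb] : exists2 b, b \in s & forall a, a \in s -> b <= a.
    by case: s s0 IH => // z s _; apply; exact: mem_head.
  have [yb|/ltW yb] := leP y b.
    exists y; first exact: mem_head.
    by move=> a; rewrite inE => /predU1P[->//|/hb]; exact: le_trans.
  exists b; first by rewrite inE bs orbT.
  by move=> a; rewrite inE => /predU1P[->//|/hb].
have := ha0; rewrite rE => /minP[b hb mb].
by exists b; split=> [|a]; rewrite rE // => /mb.
Qed.

(* Main.v *)
(** With t = xi / n, the quadratic form of M(xi) + 1 is
    sum_j cos^2(pi t j) v_j^2 + 1/4 sum_j (v_j + v_(j+1))^2, indices mod n.
    A cross term 2 v_j v_(j+1) is at least -(r_j v_j^2 + v_(j+1)^2 / r_j) for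
    every r_j > 0.  The choice r_j = 1 + sin(2 pi t (j + 1/2)) / 4, which is
    n-periodic, mimics the Gaussian ground states sitting at the zeros of
    cos(pi t j) and makes every diagonal coefficient at least sin(pi t) / 16.
    Since t <= 1 / ln 3 < 1, sin(pi t) is bounded below by a multiple of t,
    hence of t^(4/3). *)
Require Import Defs.
From HB Require Import structures.
From mathcomp Require Import all_boot all_order all_algebra.
From mathcomp Require Import all_classical all_reals all_analysis.
From mathcomp Require Import ring lra zify.
Import Order.TTheory GRing.Theory Num.Theory.
Import numFieldNormedType.Exports.
Local Open Scope ring_scope.

Lemma ln3_gt1 (R : realType) : 1 < ln (3 : R).
Proof.
(* The power is 2.985..., just below 3, and ln (1 - 1/6) <= -1/6 gives ln (6/5) >= 1/6. *)
have h : 1 <= ln ((6 / 5) ^+ 6 : R).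
  have lnV5 : ln (1 + - 6^-1 : R) <= - 6^-1 by apply: le_ln1Dx; lra.
  have e : 6 / 5 = (1 + - 6^-1 : R)^-1 by field.
  rewrite e lnXn ?invr_gt0; last by lra.
  by rewrite lnV ?posrE; [rewrite -[leRHS]mulr_natr; lra | lra].
apply: le_lt_trans h _; rewrite ltr_ln ?posrE; lra.
Qed.

(** Halving the angle keeps [x = pi * t / 2] below pi / 2 even when t is close to 1. There cos x >=
    c, the mean value theorem gives sin x >= c x, and sin (2 x) = 2 sin x cos x. *)
Lemma sin_pi_ge_linear (R : realType) (d t : R) : d < 1 -> 0 < t <= d ->
  cos (pi * d / 2) ^+ 2 * pi * t <= sin (pi * t).
Proof.
move=> d1 /andP[t0 td]; have pi0 := pi_gt0 R.
set x := pi * t / 2; set c := cos _.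
have x0 : 0 < x by rewrite /x; nra.
have xd : x <= pi * d / 2 by rewrite /x; nra.
have dpi : pi * d / 2 < pi by nra.
have c0 : 0 < c by apply: cos_gt0_pihalf; apply/andP; split; nra.
have cos_ge z : 0 <= z <= x -> c <= cos z.
  move=> /andP[z0 zx]; rewrite leNgt; apply/negP.
  by rewrite ltr_cos ?in_itv /=; [move=> ?; lra| |]; apply/andP; split; lra.
have sinx : c * x <= sin x.
  have [|z] := @MVT R sin cos _ _ x0 (fun z _ => is_derive_sin z).
    by apply: continuous_subspaceT; exact: continuous_sin.
  rewrite in_itv /= sin0 !subr0 => /andP[z0 zx] ->.
  by rewrite ler_wpM2r ?(ltW x0) // cos_ge // !ltW.
have cosx : c <= cos x by apply: cos_ge; rewrite lexx ltW.
have -> : pi * t = x *+ 2 by rewrite /x -mulr_natr; field.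
rewrite sin_mulr2n -mulr_natr.
have -> : c ^+ 2 * pi * t = c * (c * x) * 2 by rewrite /x; field.
rewrite ler_pM2r //; apply: ler_pM => //; nra.
Qed.

(** Pair the eigenvalue equation with [v] and apply weighted AM-GM on each edge of the cycle: vertex
    [j] pays [r j] for the edge to its successor and the inverse of [r (ord_pred j)] for the edge
    from its predecessor. *)
Lemma cyclic_eigenvalue_ge (R : realType) (n : nat) (v d r : 'I_n -> R)
    (b c : R) : (forall j, 0 < r j) -> (exists j, v j != 0) ->
  (forall j, b * v j = d j * v j + (v (ordS j) + v (ord_pred j)) / 4) ->
  (forall j, c <= d j - (r j + (r (ord_pred j))^-1) / 4) -> c <= b.
Proof.
move=> r0 [j0 vj0] eig cd.
have v2 : 0 < \sum_j v j ^+ 2.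
  rewrite (bigD1 j0) //= ltr_wpDr //; first by apply: sumr_ge0 => j _; apply: sqr_ge0.
  by rewrite exprn_even_gt0.
rewrite -(ler_pM2r v2) !mulr_sumr.
have sumS (F : 'I_n -> R) : \sum_j F j = \sum_j F (ordS j).
  by apply: reindex; apply: onW_bij; apply: ordS_bij.
apply: (@le_trans _ _
    (\sum_j (d j - (r j + (r (ord_pred j))^-1) / 4) * v j ^+ 2)).
  by apply: ler_sum => j _; rewrite ler_wpM2r // sqr_ge0.
(* Shifting the inverse weights by one index groups the sum by edges. *)
have -> : \sum_j (d j - (r j + (r (ord_pred j))^-1) / 4) * v j ^+ 2 =
    \sum_j (d j * v j ^+ 2 - r j * v j ^+ 2 / 4 - v (ordS j) ^+ 2 / r j / 4).
  rewrite [RHS]sumrB [X in _ = _ - X](_ : _ = \sum_j v j ^+ 2 / r (ord_pred j) / 4).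
    by rewrite -sumrB; apply: eq_bigr => j _; ring.
  by rewrite [RHS]sumS; apply: eq_bigr => j _; rewrite ordSK.
have -> : \sum_j b * v j ^+ 2 =
    \sum_j (d j * v j ^+ 2 + v j * v (ordS j) / 2).
  have -> : \sum_j (d j * v j ^+ 2 + v j * v (ordS j) / 2) =
    \sum_j (d j * v j ^+ 2 + v j * v (ordS j) / 4) + \sum_j v j * v (ord_pred j) / 4.
    rewrite [X in _ = _ + X]sumS -big_split /=; apply: eq_bigr => j _.
    by rewrite ordSK; field.
  rewrite -big_split /=; apply: eq_bigr => j _.
  by rewrite expr2 mulrA eig; field.
apply: ler_sum => j _; rewrite -subr_ge0.
have -> : d j * v j ^+ 2 + v j * v (ordS j) / 2 -
    (d j * v j ^+ 2 - r j * v j ^+ 2 / 4 - v (ordS j) ^+ 2 / r j / 4) =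
    (r j * v j + v (ordS j)) ^+ 2 / r j / 4.
  by field; rewrite gt_eqF.
by rewrite !divr_ge0 ?sqr_ge0 // ltW.
Qed.

(** To first order the two weights contribute -(sin (x + y) - sin (x - y)) / 16 = -cos x sin y / 8,
    a gain of sin y / 8 where cos x = -1; elsewhere (1 + cos x) / 2 dominates the errors. *)
Lemma sin_weight_ge (R : realType) (x y : R) : 0 <= sin y ->
  -1 + sin y / 16 <=
  1 / 2 * cos x - (1 + sin (x + y) / 4 + (1 + sin (x - y) / 4)^-1) / 4.
Proof.
move=> S0; have S1 := sin_le1 y.
(* The coefficient 1/12 gives equality at sin (x - y) = -1. *)
have hz : (1 + sin (x - y) / 4)^-1 <=
    1 - sin (x - y) / 4 + sin (x - y) ^+ 2 / 12.
  have := sin_geN1 (x - y); have := sin_le1 (x - y).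
  move: (sin (x - y)) => z z1 zN1.
  have q : 0 < 1 + z / 4 by lra.
  rewrite -[leLHS]mul1r ler_pdivrMr // -subr_ge0.
  have -> : (1 - z / 4 + z ^+ 2 / 12) * (1 + z / 4) - 1 =
    z ^+ 2 * (1 + z) / 48 by field.
  by rewrite divr_ge0 // mulr_ge0 ?sqr_ge0 //; lra.
have hz2 : sin (x - y) ^+ 2 <= 2 * sin x ^+ 2 + 2 * sin y ^+ 2.
  rewrite sinB; have := sqr_ge0 (sin x * cos y + cos x * sin y).
  have := cos2Dsin2 x; have := cos2Dsin2 y.
  have := sqr_ge0 (sin x * sin y).
  move: (sin x) (cos x) (sin y) (cos y) => A B S T h0 h1 h2 h3.
  have -> : 2 * A ^+ 2 + 2 * S ^+ 2 = 2 * (A ^+ 2 * (T ^+ 2 + S ^+ 2)) +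
    2 * (S ^+ 2 * (B ^+ 2 + A ^+ 2)) by rewrite h1 h2 !mulr1.
  nra.
move: (1 + _ / 4)^-1 hz hz2 => q; rewrite sinB sinD => hq hz2.
have := cos2Dsin2 x; have := cos_le1 x; have := cos_geN1 x.
move: S0 S1 hq hz2; move: (sin x) (cos x) (sin y) (cos y).
move=> A B S T S0 S1 hq hz2 BN1 B1 AB.
(* Both the quadratic error in sin x and the loss (1 + cos x) sin y / 8 are thus absorbed by (1 +
   cos x) / 2; the remaining S^2 / 24 is at most S / 24. *)
have A2 : A ^+ 2 <= 2 * (1 + B) by nra.
have BS : (1 + B) * S <= 1 + B by nra.
nra.
Qed.

Lemma ME (R : realType) (n : nat) (xi : int) (i j : 'I_n) : (3 <= n)%N ->
  M R n xi i j = (i == j)%:R * (1 / 2 * cos (2 * pi * xi%:~R * j%:R / n%:R)) +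
    (i == ordS j)%:R / 4 + (i == ord_pred j)%:R / 4.
Proof.
move=> n3; rewrite mxE.
have Sj : (i == ordS j) = ((i == j.+1 :> nat) || (i == 0%N :> nat) && (j == n.-1 :> nat)).
  rewrite -val_eqE /=; have [jn|jn] := ltnP j.+1 n.
    by rewrite modn_small //; lia.
  have -> : j.+1 = n by have := ltn_ord j; lia.
  by rewrite modnn; have := ltn_ord i; have := ltn_ord j; lia.
have Pj : (i == ord_pred j) = ((j == i.+1 :> nat) || (i == n.-1 :> nat) && (j == 0%N :> nat)).
  rewrite -val_eqE /=; have [j0|j0] := posnP j.
    by rewrite j0 add0n modn_small; have := ltn_ord i; lia.
  have -> : (j + n).-1 = (j.-1 + n)%N by lia.
  by rewrite modnDr modn_small; have := ltn_ord i; have := ltn_ord j; lia.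
rewrite Sj Pj.
have [<-|ij] := eqVneq i j.
  have -> : (i == i.+1 :> nat) || (i == 0%N :> nat) && (i == n.-1 :> nat) = false by lia.
  have -> : (i == i.+1 :> nat) || (i == n.-1 :> nat) && (i == 0%N :> nat) = false by lia.
  by rewrite mulr0n !mul0r !addr0 [RHS]mul1r.
rewrite mulr0n mul0r add0r.
rewrite orbCA [X in _ || X]orbCA orbA.
set s := (i == j.+1 :> nat) || _; set p := (j == i.+1 :> nat) || _.
(* For n = 2 successor and predecessor would coincide and the two quarters would add up; [3 <= n]
   excludes this. *)
have : ~~ (s && p) by rewrite /s /p; lia.
by case: s; case: p => //= _; rewrite ?mulr0n ?mulr1n !mul0r ?addr0 ?add0r.
Qed.

Lemma row_mulM (R : realType) (n : nat) (xi : int) (v : 'rV[R]_n) (j : 'I_n) :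
  (3 <= n)%N ->
  (v *m M R n xi) 0 j = 1 / 2 * cos (2 * pi * xi%:~R * j%:R / n%:R) * v 0 j +
    (v 0 (ordS j) + v 0 (ord_pred j)) / 4.
Proof.
move=> n3; rewrite mxE.
under eq_bigr => i _ do rewrite ME // mulrDr mulrDr.
have delta (k : 'I_n) (a : R) : \sum_i v 0 i * ((i == k)%:R * a) = v 0 k * a.
  rewrite (bigD1 k) //= eqxx mul1r big1 ?addr0 // => i /negbTE ->.
  by rewrite mulr0n mul0r mulr0.
by rewrite !big_split /= !delta; ring.
Qed.

Lemma eigenvalue_M_ge_sin (R : realType) (n k : nat) (beta : R) :
  (3 <= n)%N -> (k <= n)%N -> eigenvalue (M R n k) beta ->
  -1 + sin (pi * (k%:R / n%:R)) / 16 <= beta.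
Proof.
move=> n3 kn eig.
have n0 : (0 : R) < n%:R by rewrite ltr0n; lia.
have nn0 : (n%:R : R) != 0 by rewrite gt_eqF.
have pi0 := pi_gt0 R.
pose y : R := pi * (k%:R / n%:R).
pose x (j : 'I_n) : R := 2 * pi * k%:R * j%:R / n%:R.
have r_gt0 (z : R) : 0 < 1 + sin z / 4 by have := sin_geN1 z; lra.
(* The phase x + y sits at j + 1/2, so one step back gives x - y; the wrap from 0 to n - 1 adds [k]
   full turns, harmless since [k] is an integer. *)
have r_pred (j : 'I_n) : sin (x (ord_pred j) + y) = sin (x j - y).
  have [j0|j0] := posnP j.
    have -> : x (ord_pred j) + y = x j - y + (pi *+ 2) *+ k.
      rewrite /x /y /= j0 add0n modn_small; last by lia.
      rewrite -subn1 natrB; last by lia.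
      rewrite -[pi *+ 2 *+ k]mulr_natr -[pi *+ 2]mulr_natr; by field; exact: nn0.
    exact: periodicn (@sinD2pi R) _ _.
  congr sin; rewrite /x /y /=.
  have -> : (j + n).-1 = (j.-1 + n)%N by lia.
  rewrite modnDr modn_small; last by have := ltn_ord j; lia.
  by rewrite -subn1 natrB //; field; exact: nn0.
have /eigenvalueP[v vM v0] := eig.
apply: (@cyclic_eigenvalue_ge R n (fun j => v 0 j) (fun j => 1 / 2 * cos (x j))
  (fun j => 1 + sin (x j + y) / 4)).
- by move=> j; exact: r_gt0.
- by have /rV0Pn[j vj] := v0; exists j.
- by move=> j; have := row_mulM R n k v j n3; rewrite vM mxE.
- move=> j; rewrite r_pred; apply: sin_weight_ge.
  apply: sin_ge0_pi; apply/andP; split.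
    by rewrite mulr_ge0 ?(ltW pi0) // divr_ge0 ?ler0n.
  by rewrite -[leRHS]mulr1 ler_pM2l // ler_pdivrMr // mul1r ler_nat.
Qed.

Theorem proposition5 (R : realType) :
  exists2 theta : R, 0 < theta &
    forall (n : nat) (xi : int), odd n -> (3 <= n)%N ->
      1 <= xi -> (xi%:~R : R) <= n%:R / ln (n%:R : R) ->
      forall beta : R, is_smallest_eigenvalue (M R n xi) beta ->
        -1 + theta * (xi%:~R / n%:R) `^ (4 / 3) <= beta.
Proof.
(* [d] bounds xi / n uniformly: xi / n <= 1 / ln n <= 1 / ln 3. *)
pose d : R := (ln 3)^-1; pose c := cos (pi * d / 2).
have ln3 := ln3_gt1 R; have pi0 := pi_gt0 R.
have d0 : 0 < d by rewrite invr_gt0; lra.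
have d1 : d < 1 by rewrite invf_lt1; lra.
have c0 : 0 < c by apply: cos_gt0_pihalf; apply/andP; split; nra.
exists (c ^+ 2 * pi / 16); first by rewrite divr_gt0 ?mulr_gt0 ?exprn_gt0.
move=> n [k|//] _ n3 k1 kn beta [eig _].
have n0 : (0 : R) < n%:R by rewrite ltr0n; lia.
have k0 : (0 : R) < k%:R by rewrite ltr0n; move: k1; lia.
have lnn : ln 3 <= ln (n%:R : R) by rewrite ler_ln ?posrE // ler_nat.
set t : R := k%:~R / n%:R.
have td : 0 < t <= d.
  rewrite divr_gt0 //= ler_pdivrMr //; apply: le_trans kn _; rewrite mulrC ler_pM2r //.
  by rewrite lef_pV2 ?posrE //; lra.
have /andP[t0 td'] := td.
have k_n : (k <= n)%N.
  by rewrite -(ler_nat R) -[leRHS]mul1r -ler_pdivrMr //; rewrite -/t; lra.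
apply: le_trans (eigenvalue_M_ge_sin _ _ _ _ n3 k_n eig).
rewrite lerD2l -[_ * pi / 16 * _]mulrAC ler_pM2r; last by lra.
apply: le_trans (sin_pi_ge_linear _ _ _ d1 td).
rewrite -/c ler_pM2l ?mulr_gt0 ?exprn_gt0 //.
by apply: ge1r_powR; lra.
Qed.
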